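(* Let $\mathcal{C}$ be a category with weak equivalences, $\mathcal{I},\mathcal{J}$ two index categories and $J\in\mathcal{J}$ an object such that the following four adjunctions exist and are derivable: $\operatorname{colim}_{\mathcal{I}}\dashv\Delta$ between $(\mathcal{C}^{\mathcal{J}})^{\mathcal{I}}$ and $\mathcal{C}^{\mathcal{J}}$; $\operatorname{colim}_{\mathcal{I}}\dashv\Delta$ between $\mathcal{C}^{\mathcal{I}}$ and $\mathcal{C}$; $\operatorname{ev}_J\dashv J_*$ between $(\mathcal{C}^{\mathcal{I}})^{\mathcal{J}}$ and $\mathcal{C}^{\mathcal{I}}$; and $\operatorname{ev}_J\dashv J_*$ between $\mathcal{C}^{\mathcal{J}}$ and $\mathcal{C}$. Write $\operatorname{hocolim}_{\mathcal{I}}\dashv\operatorname{Ho}\Delta$ and $\operatorname{Ho}\operatorname{ev}_J\dashv\mathbb{R}J_*$ for the derived adjunctions. Suppose moreover that $\operatorname{Ho}\Delta\colon\operatorname{Ho}\mathcal{C}\to\operatorname{Ho}(\mathcal{C}^{\mathcal{I}})$ composes with $\mathbb{R}J_*\colon\operatorname{Ho}(\mathcal{C}^{\mathcal{I}})\to\operatorname{Ho}((\mathcal{C}^{\mathcal{I}})^{\mathcal{J}})$. Then the square expressing the equality $$\operatorname{Ho}\operatorname{ev}_J\circ\operatorname{Ho}\Delta=\operatorname{Ho}\Delta\circ\operatorname{Ho}\operatorname{ev}_J\colon\ \operatorname{Ho}(\mathcal{C}^{\mathcal{J}})\to\operatorname{Ho}(\mathcal{C}^{\mathcal{I}})$$ (filled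 with the identity transformation) satisfies the horizontal Beck–Chevalley condition, i.e. the mate of the identity with respect to the two adjunctions $\operatorname{hocolim}_{\mathcal{I}}\dashv\operatorname{Ho}\Delta$ is an isomorphism $$\sigma_J\colon\operatorname{hocolim}_{\mathcal{I}}\circ\operatorname{Ho}\operatorname{ev}_J\ \cong\ \operatorname{Ho}\operatorname{ev}_J\circ\operatorname{hocolim}_{\mathcal{I}}.$$ In particular there is such an isomorphism natural in $J\in\mathcal{J}$: if the hypotheses hold for $J$ and $J'$ and $j\colon J\to J'$ is a morphism of $\mathcal{J}$, then $(\operatorname{Ho}\operatorname{ev}_j)_{\operatorname{hocolim}_{\mathcal{I}}}\circ\sigma_J=\sigma_{J'}\circ\operatorname{hocolim}_{\mathcal{I}}(\operatorname{Ho}\operatorname{ev}_j)$.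
   Context: A category with weak equivalences is a category $\mathcal{C}$ with a class of morphisms (the weak equivalences), assumed to contain all isomorphisms. Its localisation $H_{\mathcal{C}}\colon\mathcal{C}\to\operatorname{Ho}\mathcal{C}$ sends weak equivalences to isomorphisms, and every functor out of $\mathcal{C}$ that does so factors uniquely (strictly) through $H_{\mathcal{C}}$. A functor $F\colon\mathcal{C}\to\mathcal{D}$ is homotopical if it preserves weak equivalences; then $\operatorname{Ho}F$ is the unique functor with $\operatorname{Ho}F\circ H_{\mathcal{C}}=H_{\mathcal{D}}\circ F$. $\operatorname{Ho}$ is strictly 2-functorial on homotopical functors. Write $K\tau$, $\tau_K$ for post- and pre-whiskering. An absolute total left derived functor of $F\colon\mathcal{C}\to\mathcal{D}$ is a pair $(\mathbb{L}F,\ \lambda\colon\mathbb{L}F\circ H_{\mathcal{C}}\Rightarrow H_{\mathcal{D}}\circ F)$ that is an absolute right Kan extension of $H_{\mathcal{D}}\circ F$ along $H_{\mathcal{C}}$ (a right Kan extension preserved by every functor out of $\operatorname{Ho}\mathcal{D}$). Dually, an absolute total right derived functor $(\mathbb{R}G,\ \rho\colon H_{\mathcal{C}}\circ G\Rightarrow\mathbb{R}G\circ H_{\mathcal{D}})$ of $G\colon\mathcal{D}\to\mathcal{C}$ is an absolute left Kan extension of $H_{\mathcal{C}}\circ G$ along $H_{\mathcal{D}}$. If $F$ is homotopical, $\operatorname{Ho}F$ with the identity is both. A derived adjunction of $(F\dashv G,\eta,\varepsilon)$ is an adjunction $(\mathbb{L}F\dashv\mathbb{R}G,\dot\eta,\dot\varepsilon)$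 with absolute total derived functors $(\mathbb{L}F,\lambda)$, $(\mathbb{R}G,\rho)$ of $F$ and $G$ such that $\mathbb{R}G\lambda\circ\dot\eta_{H_{\mathcal{C}}}=\rho_F\circ H_{\mathcal{C}}\eta$ and $\dot\varepsilon_{H_{\mathcal{D}}}\circ\mathbb{L}F\rho=H_{\mathcal{D}}\varepsilon\circ\lambda_G$; if one exists, $F\dashv G$ is derivable. If $G\colon\mathcal{C}\to\mathcal{D}$ and $G'\colon\mathcal{D}\to\mathcal{E}$ have absolute total right derived functors $(\mathbb{R}G,\rho)$, $(\mathbb{R}G',\rho')$, then $\mathbb{R}G$ composes with $\mathbb{R}G'$ if $(\mathbb{R}G'\circ\mathbb{R}G,\ \mathbb{R}G'\rho\circ\rho'_G)$ is an absolute total right derived functor of $G'\circ G$. Diagram categories $\mathcal{C}^{\mathcal{I}}$ carry pointwise weak equivalences; $\Delta$ is the constant diagram functor and $\operatorname{ev}_J\colon\mathcal{C}^{\mathcal{J}}\to\mathcal{C}$ evaluation at $J$ (both are homotopical); $J_*$ denotes a right adjoint of $\operatorname{ev}_J$; $\operatorname{hocolim}_{\mathcal{I}}:=\mathbb{L}\operatorname{colim}_{\mathcal{I}}$. One identifies $\operatorname{Ho}((\mathcal{C}^{\mathcal{I}})^{\mathcal{J}})\cong\operatorname{Ho}((\mathcal{C}^{\mathcal{J}})^{\mathcal{I}})$ via the canonical isomorphism. For $j\colon J\to J'$, $\operatorname{Ho}\operatorname{ev}_j\colon\operatorname{Ho}\operatorname{ev}_J\Rightarrow\operatorname{Ho}\operatorname{ev}_{J'}$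 is the transformation induced by evaluating diagrams at $j$. Mates: given adjunctions $(F\dashv G,\eta,\varepsilon)\colon\mathcal{A}\rightleftarrows\mathcal{B}$, $(F'\dashv G',\eta',\varepsilon')\colon\mathcal{A}'\rightleftarrows\mathcal{B}'$ and functors $X\colon\mathcal{A}\to\mathcal{A}'$, $Y\colon\mathcal{B}\to\mathcal{B}'$, the mate of $\tau\colon XG\Rightarrow G'Y$ is $\varepsilon'_{YF}\circ F'\tau_F\circ F'X\eta\colon F'X\Rightarrow YF$. The square $(X,Y,G,G',\tau)$ satisfies the (horizontal) Beck–Chevalley condition if this mate is an isomorphism. *)

(* Defs.v *)
From Stdlib Require Import FunctionalExtensionality ProofIrrelevance.

Set Implicit Arguments.
Unset Strict Implicit.
Unset Printing Implicit Defensive.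

Declare Scope cat_scope.
Delimit Scope cat_scope with cat.
Open Scope cat_scope.

Reserved Notation "g ∘ f" (at level 40, left associativity).
Reserved Notation "G ⊙ F" (at level 40, left associativity).
Reserved Notation "β • α" (at level 40, left associativity).

(** Equality of morphisms, of functors and of natural transformations is [=].
    All categories (index categories, localisations, test categories of
    universal properties) live in one arbitrary universe. *)

Record category := Category {
  obj :> Type;
  hom : obj -> obj -> Type;
  idm : forall x, hom x x;
  comp : forall x y z, hom y z -> hom x y -> hom x z;
  comp_idl : forall x y (f : hom x y), comp (idm y) f = f;
  comp_idr : forall x y (f : hom x y), comp f (idm x) = f;
  comp_assoc : forall w x y z (h : hom y z) (g : hom x y) (f : hom w x),
    comp h (comp g f) = comp (comp h g) f
}.
Arguments hom {c} _ _.
Arguments idm {c} x.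
Arguments comp {c x y z} _ _.
Notation "g ∘ f" := (comp g f) : cat_scope.

Definition is_iso (C : category) (x y : C) (f : hom x y) : Prop :=
  exists g : hom y x, g ∘ f = idm x /\ f ∘ g = idm y.

Record functor (C D : category) := Functor {
  fob :> C -> D;
  fmap : forall x y, hom x y -> hom (fob x) (fob y);
  fmap_id : forall x, fmap (idm x) = idm (fob x);
  fmap_comp : forall x y z (g : hom y z) (f : hom x y),
    fmap (g ∘ f) = fmap g ∘ fmap f
}.
Arguments fmap {C D} f0 {x y} _.

Lemma functor_eq (C D : category) (ob : C -> D)
    (fm : forall x y, hom x y -> hom (ob x) (ob y)) i i' c c' :
  @Functor C D ob fm i c = @Functor C D ob fm i' c'.
Proof.
rewrite (proof_irrelevance _ i' i), (proof_irrelevance _ c' c); reflexivity.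
Qed.

Definition id_functor (C : category) : functor C C :=
  @Functor C C (fun x => x) (fun _ _ f => f)
    (fun _ => eq_refl) (fun _ _ _ _ _ => eq_refl).

Definition comp_functor (C D E : category) (G : functor D E) (F : functor C D) :
  functor C E.
Proof.
refine (@Functor C E (fun x => G (F x)) (fun _ _ f => fmap G (fmap F f)) _ _).
- intros x; rewrite !fmap_id; reflexivity.
- intros x y z g f; rewrite !fmap_comp; reflexivity.
Defined.
Notation "G ⊙ F" := (comp_functor G F) : cat_scope.

Lemma comp_functor_assoc (A B C D : category) (H : functor C D) (G : functor B C)
    (F : functor A B) : (H ⊙ G) ⊙ F = H ⊙ (G ⊙ F).
Proof. apply functor_eq. Qed.

Record nat_trans (C D : category) (F G : functor C D) := NatTrans {
  nt :> forall x : C, hom (F x) (G x);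
  nt_natural : forall x y (f : hom x y), nt y ∘ fmap F f = fmap G f ∘ nt x
}.

Lemma nat_trans_ext (C D : category) (F G : functor C D) (α β : nat_trans F G) :
  (forall x, α x = β x) -> α = β.
Proof.
destruct α as [a p], β as [b q]; cbn; intros e.
assert (a = b) as ->
  by (apply functional_extensionality_dep; exact e).
rewrite (proof_irrelevance _ p q); reflexivity.
Qed.

Definition nt_id (C D : category) (F : functor C D) : nat_trans F F.
Proof.
refine (@NatTrans C D F F (fun x => idm (F x)) _).
intros x y f; rewrite comp_idl, comp_idr; reflexivity.
Defined.

Definition nt_comp (C D : category) (F G H : functor C D)
  (β : nat_trans G H) (α : nat_trans F G) : nat_trans F H.
Proof.
refine (@NatTrans C D F H (fun x => β x ∘ α x) _).
intros x y f.
rewrite <- comp_assoc, nt_natural, comp_assoc, nt_natural, <- comp_assoc.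
reflexivity.
Defined.
Notation "β • α" := (nt_comp β α) : cat_scope.

(** The identity transformation between (provably) equal functors. *)
Definition nt_of_eq (C D : category) (F G : functor C D) (e : F = G) :
  nat_trans F G :=
  match e with eq_refl => nt_id F end.

(** Post-whiskering [T α] and pre-whiskering [α_K]. *)
Definition whisker_l (C D E : category) (T : functor D E) (F G : functor C D)
  (α : nat_trans F G) : nat_trans (T ⊙ F) (T ⊙ G).
Proof.
refine (@NatTrans C E (T ⊙ F) (T ⊙ G) (fun x => fmap T (α x)) _).
intros x y f; cbn; rewrite <- !fmap_comp, nt_natural; reflexivity.
Defined.

Definition whisker_r (B C D : category) (F G : functor C D)
  (α : nat_trans F G) (K : functor B C) : nat_trans (F ⊙ K) (G ⊙ K).
Proof.
refine (@NatTrans B D (F ⊙ K) (G ⊙ K) (fun x => α (K x)) _).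
intros x y f; cbn; apply nt_natural.
Defined.

Definition hom_of_eq (C : category) (x y : C) (e : x = y) : hom x y :=
  match e with eq_refl => idm x end.

Lemma nt_of_eqE (C D : category) (F G : functor C D) (e : F = G) (x : C) :
  nt_of_eq e x = hom_of_eq (f_equal (fun K : functor C D => K x) e).
Proof. destruct e; reflexivity. Qed.

Lemma hom_of_eq_id (C : category) (x : C) (e : x = x) : hom_of_eq e = idm x.
Proof. rewrite (proof_irrelevance _ e eq_refl); reflexivity. Qed.

Lemma hom_of_eq_comp (C : category) (x y z : C) (e : x = y) (e' : y = z) :
  hom_of_eq e' ∘ hom_of_eq e = hom_of_eq (eq_trans e e').
Proof. destruct e', e; apply comp_idl. Qed.

Lemma functor_ext (C D : category) (F G : functor C D)
    (e : forall x, F x = G x) :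
  (forall x y (f : hom x y),
     hom_of_eq (e y) ∘ fmap F f = fmap G f ∘ hom_of_eq (e x)) -> F = G.
Proof.
destruct F as [ob fm i c], G as [ob' fm' i' c']; cbn in *.
assert (ob = ob') as <- by (apply functional_extensionality; exact e).
intros n.
assert (fm = fm') as <-.
{ do 3 (apply functional_extensionality_dep; intro).
  specialize (n _ _ x1); rewrite !hom_of_eq_id, comp_idl, comp_idr in n.
  exact n. }
apply functor_eq.
Qed.

Definition functor_category (C D : category) : category.
Proof.
refine (@Category (functor C D) (fun F G => nat_trans F G)
          (fun F => nt_id F) (fun F G H β α => β • α) _ _ _);
  intros; apply nat_trans_ext; intros; cbn;
  [apply comp_idl | apply comp_idr | apply comp_assoc].
Defined.

Record adjunction (A B : category) (F : functor A B) (G : functor B A) := Adjunction {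
  unit : nat_trans (id_functor A) (G ⊙ F);
  counit : nat_trans (F ⊙ G) (id_functor B);
  triangle_l : forall a, counit (F a) ∘ fmap F (unit a) = idm (F a);
  triangle_r : forall b, fmap G (counit b) ∘ unit (G b) = idm (G b)
}.

Definition mate (A B A' B' : category)
  (F : functor A B) (G : functor B A) (adj : adjunction F G)
  (F' : functor A' B') (G' : functor B' A') (adj' : adjunction F' G')
  (X : functor A A') (Y : functor B B')
  (τ : nat_trans (X ⊙ G) (G' ⊙ Y)) : nat_trans (F' ⊙ X) (Y ⊙ F).
Proof.
refine (@NatTrans A B' (F' ⊙ X) (Y ⊙ F)
  (fun a => counit adj' (Y (F a)) ∘ fmap F' (τ (F a))
              ∘ fmap F' (fmap X (unit adj a))) _).
intros a b f; cbn.
pose proof (nt_natural (unit adj) f) as e1; cbn in e1.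
pose proof (nt_natural τ (fmap F f)) as e2; cbn in e2.
pose proof (nt_natural (counit adj') (fmap Y (fmap F f))) as e3; cbn in e3.
rewrite comp_assoc, comp_assoc, <- e3.
rewrite <- !comp_assoc; f_equal.
rewrite <- !fmap_comp, e1, (fmap_comp X), !comp_assoc, e2.
reflexivity.
Defined.

Definition beck_chevalley (A B A' B' : category)
  (F : functor A B) (G : functor B A) (adj : adjunction F G)
  (F' : functor A' B') (G' : functor B' A') (adj' : adjunction F' G')
  (X : functor A A') (Y : functor B B')
  (τ : nat_trans (X ⊙ G) (G' ⊙ Y)) : Prop :=
  is_iso (C := functor_category A B') (mate adj adj' τ).

Definition is_ran (A B D : category) (K : functor A B) (F : functor A D)
  (R : functor B D) (ε : nat_trans (R ⊙ K) F) : Prop :=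
  forall (S : functor B D) (α : nat_trans (S ⊙ K) F),
    exists! σ : nat_trans S R, ε • whisker_r σ K = α.

Definition is_lan (A B D : category) (K : functor A B) (F : functor A D)
  (L : functor B D) (η : nat_trans F (L ⊙ K)) : Prop :=
  forall (S : functor B D) (α : nat_trans F (S ⊙ K)),
    exists! σ : nat_trans L S, whisker_r σ K • η = α.

(** [T ε] and [T η], retyped along [T ⊙ (R ⊙ K) = (T ⊙ R) ⊙ K]: the two sides
    agree definitionally on objects and morphisms. *)
Definition push_ran (A B D E : category) (K : functor A B) (F : functor A D)
  (R : functor B D) (T : functor D E) (ε : nat_trans (R ⊙ K) F) :
  nat_trans ((T ⊙ R) ⊙ K) (T ⊙ F) :=
  @NatTrans A E ((T ⊙ R) ⊙ K) (T ⊙ F) (fun x => fmap T (ε x))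
    (nt_natural (whisker_l T ε)).

Definition push_lan (A B D E : category) (K : functor A B) (F : functor A D)
  (L : functor B D) (T : functor D E) (η : nat_trans F (L ⊙ K)) :
  nat_trans (T ⊙ F) ((T ⊙ L) ⊙ K) :=
  @NatTrans A E (T ⊙ F) ((T ⊙ L) ⊙ K) (fun x => fmap T (η x))
    (nt_natural (whisker_l T η)).

Definition is_absolute_ran (A B D : category) (K : functor A B) (F : functor A D)
  (R : functor B D) (ε : nat_trans (R ⊙ K) F) : Prop :=
  is_ran ε /\
  forall (E : category) (T : functor D E), is_ran (push_ran T ε).

Definition is_absolute_lan (A B D : category) (K : functor A B) (F : functor A D)
  (L : functor B D) (η : nat_trans F (L ⊙ K)) : Prop :=
  is_lan η /\
  forall (E : category) (T : functor D E), is_lan (push_lan T η).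

Record wcategory := WCategory {
  wcat :> category;
  weq : forall x y : wcat, hom x y -> Prop;
  weq_iso : forall (x y : wcat) (f : hom x y), is_iso f -> weq f
}.
Arguments weq {w x y} _.

Definition homotopical (C D : wcategory) (F : functor C D) : Prop :=
  forall (x y : C) (f : hom x y), weq f -> weq (fmap F f).

Definition inverts_weq (C : wcategory) (D : category) (F : functor C D) : Prop :=
  forall (x y : C) (f : hom x y), weq f -> is_iso (fmap F f).

Record localisation (C : wcategory) := Localisation {
  Ho :> category;
  loc : functor C Ho;
  loc_inverts : inverts_weq loc;
  loc_lift : forall (D : category) (F : functor C D), inverts_weq F -> functor Ho D;
  loc_lift_loc : forall (D : category) (F : functor C D) (h : inverts_weq F),
    loc_lift h ⊙ loc = F;
  loc_lift_unique : forall (D : category) (F : functor C D) (h : inverts_weq F)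
    (G : functor Ho D), G ⊙ loc = F -> G = loc_lift h
}.
Arguments loc {C} l.

Lemma loc_functor_eq (C : wcategory) (HC : localisation C) (D : category)
    (G G' : functor HC D) : G ⊙ loc HC = G' ⊙ loc HC -> G = G'.
Proof.
intros e.
assert (h : inverts_weq (G' ⊙ loc HC)).
{ intros x y f w; destruct (loc_inverts HC w) as [g [gf fg]].
  exists (fmap G' g); cbn.
  rewrite <- !fmap_comp, gf, fg, !fmap_id; split; reflexivity. }
rewrite (loc_lift_unique h e); symmetry.
apply loc_lift_unique; reflexivity.
Qed.

Lemma inverts_loc_comp (C D : wcategory) (HD : localisation D) (F : functor C D) :
  homotopical F -> inverts_weq (loc HD ⊙ F).
Proof. intros h x y f w; exact (loc_inverts HD (h x y f w)). Qed.

Lemma comp_homotopical (C D E : wcategory) (G : functor D E) (F : functor C D) :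
  homotopical G -> homotopical F -> homotopical (G ⊙ F : functor C E).
Proof. intros hG hF x y f w; exact (hG _ _ _ (hF _ _ _ w)). Qed.

Definition Ho_fun (C D : wcategory) (HC : localisation C) (HD : localisation D)
  (F : functor C D) (h : homotopical F) : functor HC HD :=
  loc_lift HC (inverts_loc_comp HD h).
Arguments Ho_fun {C D} HC HD {F} h.

Lemma Ho_fun_loc (C D : wcategory) (HC : localisation C) (HD : localisation D)
    (F : functor C D) (h : homotopical F) : Ho_fun HC HD h ⊙ loc HC = loc HD ⊙ F.
Proof. apply loc_lift_loc. Qed.

Lemma Ho_fun_comp (C D E : wcategory) (HC : localisation C) (HD : localisation D)
    (HE : localisation E) (G : functor D E) (F : functor C D)
    (hG : homotopical G) (hF : homotopical F)
    (hGF : homotopical (G ⊙ F : functor C E)) :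
  Ho_fun HD HE hG ⊙ Ho_fun HC HD hF = Ho_fun HC HE hGF.
Proof.
apply loc_functor_eq.
rewrite comp_functor_assoc, !Ho_fun_loc, <- comp_functor_assoc, Ho_fun_loc.
apply comp_functor_assoc.
Qed.

Lemma Ho_fun_eq (C D : wcategory) (HC : localisation C) (HD : localisation D)
    (F G : functor C D) (hF : homotopical F) (hG : homotopical G) :
  F = G -> Ho_fun HC HD hF = Ho_fun HC HD hG.
Proof. intros ->; apply loc_functor_eq; rewrite !Ho_fun_loc; reflexivity. Qed.

(** A transformation [F ⇒ F'] is the same as a functor to the arrow category
    with domain [F] and codomain [F'], so the strict universal property of the
    localisation also produces [Ho τ : Ho F ⇒ Ho F'] ([Ho_nt] below), with
    [(Ho τ)_H = H τ] by [Ho_nt_loc]. *)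

Record arrow (C : category) := Arrow { adom : C; acod : C; amap : hom adom acod }.

Record arrow_hom (C : category) (a b : arrow C) := ArrowHom {
  ahom_dom : hom (adom a) (adom b);
  ahom_cod : hom (acod a) (acod b);
  ahom_square : ahom_cod ∘ amap a = amap b ∘ ahom_dom
}.

Lemma arrow_hom_eq (C : category) (a b : arrow C) (f g : arrow_hom a b) :
  ahom_dom f = ahom_dom g -> ahom_cod f = ahom_cod g -> f = g.
Proof.
destruct f as [f1 f2 f3], g as [g1 g2 g3]; cbn; intros e1 e2; subst g1 g2.
rewrite (proof_irrelevance _ f3 g3); reflexivity.
Qed.

Definition arrow_id (C : category) (a : arrow C) : arrow_hom a a.
Proof.
refine (@ArrowHom C a a (idm _) (idm _) _).
rewrite comp_idl, comp_idr; reflexivity.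
Defined.

Definition arrow_comp (C : category) (a b c : arrow C)
  (g : arrow_hom b c) (f : arrow_hom a b) : arrow_hom a c.
Proof.
refine (@ArrowHom C a c (ahom_dom g ∘ ahom_dom f) (ahom_cod g ∘ ahom_cod f) _).
rewrite <- comp_assoc, ahom_square, comp_assoc, ahom_square, comp_assoc.
reflexivity.
Defined.

Definition arrow_category (C : category) : category.
Proof.
refine (@Category (arrow C) (@arrow_hom C) (@arrow_id C) (@arrow_comp C) _ _ _);
  intros; apply arrow_hom_eq; cbn;
  solve [apply comp_idl | apply comp_idr | apply comp_assoc].
Defined.

Definition dom_functor (C : category) : functor (arrow_category C) C :=
  @Functor (arrow_category C) C (@adom C) (@ahom_dom C)
    (fun _ => eq_refl) (fun _ _ _ _ _ => eq_refl).

Definition cod_functor (C : category) : functor (arrow_category C) C :=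
  @Functor (arrow_category C) C (@acod C) (@ahom_cod C)
    (fun _ => eq_refl) (fun _ _ _ _ _ => eq_refl).

Definition arrow_of_nt (C D : category) (F F' : functor C D)
  (τ : nat_trans F F') : functor C (arrow_category D).
Proof.
refine (@Functor C (arrow_category D) (fun x => Arrow (τ x))
  (fun x y f => @ArrowHom D (Arrow (τ x)) (Arrow (τ y)) (fmap F f) (fmap F' f)
                  (eq_sym (nt_natural τ f))) _ _).
- intros x; apply arrow_hom_eq; cbn; apply fmap_id.
- intros x y z g f; apply arrow_hom_eq; cbn; apply fmap_comp.
Defined.

Definition nt_of_arrow (C D : category) (K : functor C (arrow_category D)) :
  nat_trans (dom_functor D ⊙ K) (cod_functor D ⊙ K).
Proof.
refine (@NatTrans C D (dom_functor D ⊙ K) (cod_functor D ⊙ K)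
  (fun x => amap (K x)) _).
intros x y f; cbn; symmetry; apply (ahom_square (fmap K f)).
Defined.

Lemma inverse_square (C : category) (a b a' b' : C) (p : hom a b) (q : hom a' b')
    (u : hom a a') (v : hom b b') (g : hom b a) (g' : hom b' a') :
  v ∘ p = q ∘ u -> p ∘ g = idm b -> g' ∘ q = idm a' -> g' ∘ v = u ∘ g.
Proof.
intros s pg gq.
rewrite <- (comp_idr v), <- pg, (comp_assoc v), s, !comp_assoc, gq, comp_idl.
reflexivity.
Qed.

Section HoNat.

Variables (C D : wcategory) (HC : localisation C) (HD : localisation D).
Variables (F F' : functor C D) (h : homotopical F) (h' : homotopical F').
Variable τ : nat_trans F F'.

Let K0 : functor C (arrow_category HD) := arrow_of_nt (whisker_l (loc HD) τ).

Lemma arrow_of_nt_inverts : inverts_weq K0.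
Proof.
intros x y f w.
destruct (inverts_loc_comp HD h w) as [g [gf fg]].
destruct (inverts_loc_comp HD h' w) as [g' [gf' fg']].
assert (e : g' ∘ amap (K0 y) = amap (K0 x) ∘ g).
{ refine (inverse_square _ fg gf').
  exact (nt_natural (whisker_l (loc HD) τ) f). }
exists (@ArrowHom HD (K0 y) (K0 x) g g' e).
split; apply arrow_hom_eq; assumption.
Qed.

Let K : functor HC (arrow_category HD) := loc_lift HC arrow_of_nt_inverts.

Lemma Ho_nt_dom : dom_functor HD ⊙ K = Ho_fun HC HD h.
Proof.
apply loc_functor_eq; rewrite Ho_fun_loc, comp_functor_assoc.
unfold K; rewrite loc_lift_loc; apply functor_eq.
Qed.

Lemma Ho_nt_cod : cod_functor HD ⊙ K = Ho_fun HC HD h'.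
Proof.
apply loc_functor_eq; rewrite Ho_fun_loc, comp_functor_assoc.
unfold K; rewrite loc_lift_loc; apply functor_eq.
Qed.

Definition Ho_nt : nat_trans (Ho_fun HC HD h) (Ho_fun HC HD h') :=
  nt_of_eq Ho_nt_cod • nt_of_arrow K • nt_of_eq (eq_sym Ho_nt_dom).

End HoNat.
Arguments Ho_nt {C D} HC HD {F F'} h h' τ.

Lemma Ho_nt_loc (C D : wcategory) (HC : localisation C) (HD : localisation D)
    (F F' : functor C D) (h : homotopical F) (h' : homotopical F')
    (τ : nat_trans F F') :
  nt_of_eq (Ho_fun_loc HC HD h') • whisker_r (Ho_nt HC HD h h' τ) (loc HC)
  = whisker_l (loc HD) τ • nt_of_eq (Ho_fun_loc HC HD h).
Proof.
apply nat_trans_ext; intros x; cbn; rewrite !nt_of_eqE.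
set (K := loc_lift HC (arrow_of_nt_inverts HD h h' τ)).
assert (e : K (loc HC x) = @Arrow HD _ _ (fmap (loc HD) (τ x))).
{ change (K (loc HC x)) with ((K ⊙ loc HC) x).
  unfold K; rewrite loc_lift_loc; reflexivity. }
rewrite !comp_assoc, hom_of_eq_comp.
rewrite <- (comp_assoc _ _ (hom_of_eq _)).
match goal with |- hom_of_eq ?p ∘ (_ ∘ hom_of_eq ?q) = _ ∘ hom_of_eq ?r =>
  generalize p q r end.
revert e; cbn.
generalize (K (loc HC x)); intros a e; subst a; cbn; intros p q r.
rewrite hom_of_eq_id, comp_idl.
rewrite (proof_irrelevance _ q r); reflexivity.
Qed.

Definition is_left_derived (C D : wcategory) (HC : localisation C)
  (HD : localisation D) (F : functor C D) (LF : functor HC HD)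
  (λ : nat_trans (LF ⊙ loc HC) (loc HD ⊙ F)) : Prop :=
  is_absolute_ran λ.

Definition is_right_derived (C D : wcategory) (HC : localisation C)
  (HD : localisation D) (G : functor D C) (RG : functor HD HC)
  (ρ : nat_trans (loc HC ⊙ G) (RG ⊙ loc HD)) : Prop :=
  is_absolute_lan ρ.

(** For [G] homotopical, the identity of [H G = Ho G H] as the structure
    transformation of [Ho G] as a right derived functor. *)
Definition Ho_rho (C D : wcategory) (HC : localisation C) (HD : localisation D)
  (G : functor D C) (h : homotopical G) :
  nat_trans (loc HC ⊙ G) (Ho_fun HD HC h ⊙ loc HD) :=
  nt_of_eq (eq_sym (Ho_fun_loc HD HC h)).
Arguments Ho_rho {C D} HC HD {G} h.

Record derived_adjunction (C D : wcategory) (HC : localisation C)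
  (HD : localisation D) (F : functor C D) (G : functor D C) (adj : adjunction F G)
  (LF : functor HC HD) (λ : nat_trans (LF ⊙ loc HC) (loc HD ⊙ F))
  (RG : functor HD HC) (ρ : nat_trans (loc HC ⊙ G) (RG ⊙ loc HD)) :=
DerivedAdjunction {
  der_adj :> adjunction LF RG;
  der_left : is_left_derived λ;
  der_right : is_right_derived ρ;
  der_unit : forall c : C,
    fmap RG (λ c) ∘ unit der_adj (loc HC c)
    = ρ (F c) ∘ fmap (loc HC) (unit adj c);
  der_counit : forall d : D,
    counit der_adj (loc HD d) ∘ fmap LF (ρ d)
    = fmap (loc HD) (counit adj d) ∘ λ (G d)
}.

Definition derivable (C D : wcategory) (HC : localisation C) (HD : localisation D)
  (F : functor C D) (G : functor D C) (adj : adjunction F G) : Prop :=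
  exists LF λ RG ρ, inhabited (@derived_adjunction C D HC HD F G adj LF λ RG ρ).
Arguments derivable {C D} HC HD {F G} adj.

(** The transformation [R'ρ ∘ ρ'_G : H G' G ⇒ R' R H]. *)
Definition comp_rho (C D E : wcategory) (HC : localisation C) (HD : localisation D)
  (HE : localisation E) (G : functor C D) (G' : functor D E)
  (RG : functor HC HD) (ρ : nat_trans (loc HD ⊙ G) (RG ⊙ loc HC))
  (RG' : functor HD HE) (ρ' : nat_trans (loc HE ⊙ G') (RG' ⊙ loc HD)) :
  nat_trans (loc HE ⊙ (G' ⊙ G)) ((RG' ⊙ RG) ⊙ loc HC).
Proof.
refine (@NatTrans C HE (loc HE ⊙ (G' ⊙ G)) ((RG' ⊙ RG) ⊙ loc HC)
  (fun c => fmap RG' (ρ c) ∘ ρ' (G c)) _).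
intros x y f; cbn.
pose proof (nt_natural ρ' (fmap G f)) as e1; cbn in e1.
pose proof (nt_natural (whisker_l RG' ρ) f) as e2; cbn in e2.
rewrite <- comp_assoc, e1, comp_assoc, e2, <- comp_assoc; reflexivity.
Defined.

Definition composes_with (C D E : wcategory) (HC : localisation C)
  (HD : localisation D) (HE : localisation E) (G : functor C D) (G' : functor D E)
  (RG : functor HC HD) (ρ : nat_trans (loc HD ⊙ G) (RG ⊙ loc HC))
  (RG' : functor HD HE) (ρ' : nat_trans (loc HE ⊙ G') (RG' ⊙ loc HD)) : Prop :=
  is_right_derived (comp_rho ρ ρ').

Definition diagram (I : category) (C : wcategory) : wcategory.
Proof.
refine (@WCategory (functor_category I C)
  (fun X Y α => forall i : I, weq ((α : nat_trans X Y) i)) _).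
intros X Y α [β [βα αβ]] i; apply weq_iso.
exists ((β : nat_trans Y X) i); split.
- exact (f_equal (fun γ : nat_trans X X => γ i) βα).
- exact (f_equal (fun γ : nat_trans Y Y => γ i) αβ).
Defined.

Definition const_object (I C : category) (c : C) : functor I C.
Proof.
refine (@Functor I C (fun _ => c) (fun _ _ _ => idm c) _ _).
- reflexivity.
- intros; rewrite comp_idl; reflexivity.
Defined.

Definition const_map (I C : category) (c d : C) (f : hom c d) :
  nat_trans (const_object I c) (const_object I d).
Proof.
refine (@NatTrans I C (const_object I c) (const_object I d) (fun _ => f) _).
intros; cbn; rewrite comp_idl, comp_idr; reflexivity.
Defined.

Definition Delta (I : category) (C : wcategory) : functor C (diagram I C).
Proof.
refine (@Functor C (diagram I C) (const_object I (C := C)) (@const_map I C) _ _);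
  intros; apply nat_trans_ext; reflexivity.
Defined.

Lemma Delta_homotopical (I : category) (C : wcategory) : homotopical (Delta I C).
Proof. intros x y f w i; exact w. Qed.
Arguments Delta_homotopical I C _ _ _ _ : clear implicits.

Definition ev (J : category) (C : wcategory) (j : J) : functor (diagram J C) C.
Proof.
refine (@Functor (diagram J C) C (fun X : functor J C => X j)
  (fun X Y (α : nat_trans X Y) => α j) _ _); reflexivity.
Defined.
Arguments ev {J} C j.

Lemma ev_homotopical (J : category) (C : wcategory) (j : J) : homotopical (ev C j).
Proof. intros X Y α w; exact (w j). Qed.
Arguments ev_homotopical {J} C j _ _ _ _.

Definition ev_map (J : category) (C : wcategory) (j j' : J) (u : hom j j') :
  nat_trans (ev C j) (ev C j').
Proof.
refine (@NatTrans (diagram J C) C (ev C j) (ev C j')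
  (fun X : functor J C => fmap X u) _).
intros X Y α; cbn; symmetry; apply nt_natural.
Defined.
Arguments ev_map {J} C {j j'} u.

Definition swap_slice (I J : category) (C : wcategory) (X : functor I (functor_category J C))
  (j : J) : functor I C :=
  comp_functor (ev C j) (X : functor I (diagram J C)).

Definition swap_object (I J : category) (C : wcategory)
  (X : functor I (functor_category J C)) : functor J (functor_category I C).
Proof.
refine (@Functor J (functor_category I C) (swap_slice X)
  (fun j j' u => whisker_r (ev_map C u) (X : functor I (diagram J C))) _ _).
- intros j; apply nat_trans_ext; intros i; cbn; apply fmap_id.
- intros j j' j'' v u; apply nat_trans_ext; intros i; cbn; apply fmap_comp.
Defined.

Definition swap_map (I J : category) (C : wcategory)
  (X Y : functor I (functor_category J C)) (α : nat_trans X Y) :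
  nat_trans (swap_object X) (swap_object Y).
Proof.
refine (@NatTrans J (functor_category I C) (swap_object X) (swap_object Y)
  (fun j => whisker_l (ev C j)
     (α : @nat_trans I (diagram J C) X Y) : nat_trans (swap_slice X j) (swap_slice Y j)) _).
intros j j' u; apply nat_trans_ext; intros i; cbn.
apply (nt_natural (α i : nat_trans (X i) (Y i))).
Defined.

Definition swap (I J : category) (C : wcategory) :
  functor (diagram I (diagram J C)) (diagram J (diagram I C)).
Proof.
refine (@Functor (diagram I (diagram J C)) (diagram J (diagram I C))
  (@swap_object I J C) (@swap_map I J C) _ _);
  intros; apply nat_trans_ext; intros j; apply nat_trans_ext; reflexivity.
Defined.

Lemma swap_homotopical (I J : category) (C : wcategory) : homotopical (swap I J C).
Proof. intros X Y α w j i; exact (w i j). Qed.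
Arguments swap_homotopical I J C _ _ _ _ : clear implicits.

Lemma ev_Delta (I J : category) (C : wcategory) (j : J) :
  (ev (diagram I C) j ⊙ swap I J C) ⊙ Delta I (diagram J C) = Delta I C ⊙ ev C j.
Proof.
refine (functor_ext (e := fun X => _) _).
Unshelve. 2: apply functor_eq.
intros X Y α; cbn.
assert (h : forall (A B : functor I C) (e : A = B) (i : I),
  (hom_of_eq (C := functor_category I C) e : nat_trans A B) i
  = hom_of_eq (f_equal (fun K : functor I C => K i) e)).
{ intros A B e i; destruct e; reflexivity. }
apply nat_trans_ext; intros i; cbn; rewrite !h, !hom_of_eq_id.
rewrite comp_idl, comp_idr; reflexivity.
Qed.

Section BeckChevalleySquare.

Variables (I J : category) (C : wcategory).
Variables (HC : localisation C)
  (HCI : localisation (diagram I C)) (HCJ : localisation (diagram J C))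
  (HCJI : localisation (diagram I (diagram J C)))
  (HCIJ : localisation (diagram J (diagram I C))).

(** [Ho ev_j : Ho((C^J)^I) -> Ho(C^I)], through the canonical isomorphism
    [Ho((C^J)^I) ≅ Ho((C^I)^J)], and its functoriality in [j]. *)

Definition Ho_ev_swap (j : J) : functor HCJI HCI :=
  Ho_fun HCIJ HCI (ev_homotopical (diagram I C) j)
  ⊙ Ho_fun HCJI HCIJ (swap_homotopical I J C).

Definition Ho_ev_swap_map (j j' : J) (u : hom j j') :
  nat_trans (Ho_ev_swap j) (Ho_ev_swap j') :=
  whisker_r (Ho_nt HCIJ HCI (ev_homotopical (diagram I C) j)
               (ev_homotopical (diagram I C) j') (ev_map (diagram I C) u))
    (Ho_fun HCJI HCIJ (swap_homotopical I J C)).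

Lemma Ho_ev_Delta (j : J) :
  Ho_ev_swap j ⊙ Ho_fun HCJ HCJI (Delta_homotopical I (diagram J C))
  = Ho_fun HC HCI (Delta_homotopical I C) ⊙ Ho_fun HCJ HC (ev_homotopical C j).
Proof.
unfold Ho_ev_swap.
pose proof (comp_homotopical (ev_homotopical (diagram I C) j)
              (swap_homotopical I J C)) as h1.
pose proof (comp_homotopical h1 (Delta_homotopical I (diagram J C))) as h2.
pose proof (comp_homotopical (Delta_homotopical I C) (ev_homotopical C j)) as h3.
rewrite (Ho_fun_comp _ _ _ _ _ h1), (Ho_fun_comp _ _ _ _ _ h2).
rewrite (Ho_fun_comp _ _ _ _ _ h3).
apply Ho_fun_eq, ev_Delta.
Qed.

(** In the second conjunct the derived adjunction witnesses derivability; its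
    left adjoint [L] is any derived functor of [ev_j], in particular it can be
    [Ho ev_j]. Its right adjoint [R] is the [R j_*] with which [Ho Δ] composes. *)
Definition ev_derivable_composes (j : J) : Prop :=
  (exists (jr : functor C (diagram J C)) (adj : adjunction (ev C j) jr),
     derivable HCJ HC adj) /\
  (exists (jr : functor (diagram I C) (diagram J (diagram I C)))
     (adj : adjunction (ev (diagram I C) j) jr)
     (L : functor HCIJ HCI)
     (λ : nat_trans (L ⊙ loc HCIJ) (loc HCI ⊙ ev (diagram I C) j))
     (R : functor HCI HCIJ)
     (ρ : nat_trans (loc HCIJ ⊙ jr) (R ⊙ loc HCI)),
     inhabited (derived_adjunction adj λ ρ) /\
     composes_with (Ho_rho HCI HC (Delta_homotopical I C)) ρ).

End BeckChevalleySquare.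

(* Main.v *)
(** Since [ev_j ⊣ J_*] on both sides, [σ_j] is conjugate to a transformation
    [Ho Δ ∘ R J_* ⇒ R J_* ∘ Ho Δ] between right adjoints, so it is enough that the
    latter is invertible. Its source is a total right derived functor of [Δ J_*]
    because [R J_*] is absolute, its target is one of [J_* Δ] by hypothesis, and it
    is the comparison induced by the canonical map [Δ J_* ⇒ J_* Δ]. That map is
    invertible: maps into either side are cocones on the [j]-th slice. *)

From Stdlib Require Import ProofIrrelevance IndefiniteDescription.
Require Import Defs.

Set Implicit Arguments.
Unset Strict Implicit.
Unset Printing Implicit Defensive.

(** * Isomorphisms and natural isomorphisms *)

Lemma is_iso_id (C : category) (x : C) : is_iso (idm x).
Proof. exists (idm x); split; apply comp_idl. Qed.

Lemma is_iso_comp (C : category) (x y z : C) (g : hom y z) (f : hom x y) :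
  is_iso g -> is_iso f -> is_iso (g ∘ f).
Proof.
intros [g' [g'g gg']] [f' [f'f ff']]; exists (f' ∘ g'); split.
- rewrite comp_assoc, <- (comp_assoc f'), g'g, comp_idr; exact f'f.
- rewrite comp_assoc, <- (comp_assoc g), ff', comp_idr; exact gg'.
Qed.

Lemma is_iso_fmap (C D : category) (F : functor C D) (x y : C) (f : hom x y) :
  is_iso f -> is_iso (fmap F f).
Proof.
intros [g [gf fg]]; exists (fmap F g).
rewrite <- !fmap_comp, gf, fg, !fmap_id; split; reflexivity.
Qed.

Lemma is_iso_hom_of_eq (C : category) (x y : C) (e : x = y) : is_iso (hom_of_eq e).
Proof. destruct e; apply is_iso_id. Qed.

Lemma is_iso_monic (C : category) (x y z : C) (f : hom y z) (g h : hom x y) :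
  is_iso f -> f ∘ g = f ∘ h -> g = h.
Proof.
intros [f' [f'f _]] e.
rewrite <- (comp_idl g), <- (comp_idl h), <- f'f, <- !comp_assoc, e; reflexivity.
Qed.

Lemma is_iso_epic (C : category) (x y z : C) (f : hom x y) (g h : hom y z) :
  is_iso f -> g ∘ f = h ∘ f -> g = h.
Proof.
intros [f' [_ ff']] e.
rewrite <- (comp_idr g), <- (comp_idr h), <- ff', !comp_assoc, e; reflexivity.
Qed.

Lemma is_iso_nat_trans (C D : category) (F G : functor C D) (α : nat_trans F G) :
  (forall x, is_iso (α x)) -> is_iso (C := functor_category C D) α.
Proof.
intros h.
(* [is_iso] only asserts that an inverse exists, so a choice principle is needed to assemble the
   pointwise inverses into one family. *)
pose (b x := proj1_sig (constructive_indefinite_description _ (h x))).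
assert (hb : forall x, b x ∘ α x = idm _ /\ α x ∘ b x = idm _)
  by (intros x; exact (proj2_sig (constructive_indefinite_description _ (h x)))).
clearbody b.
assert (nb : forall x y (f : hom x y), b y ∘ fmap G f = fmap F f ∘ b x).
{ intros x y f; apply (is_iso_epic (h x)).
  rewrite <- (comp_assoc (b y)), <- nt_natural, <- (comp_assoc (fmap F f)).
  rewrite (proj1 (hb x)), comp_assoc, (proj1 (hb y)), comp_idl, comp_idr.
  reflexivity. }
exists (NatTrans nb); split; apply nat_trans_ext; intros x; apply hb.
Qed.

Lemma nat_trans_is_iso (C D : category) (F G : functor C D) (α : nat_trans F G)
    (x : C) : is_iso (C := functor_category C D) α -> is_iso (α x).
Proof.
intros [β [βα αβ]]; exists ((β : nat_trans G F) x); split.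
- exact (f_equal (fun γ : nat_trans F F => γ x) βα).
- exact (f_equal (fun γ : nat_trans G G => γ x) αβ).
Qed.

Lemma is_iso_nt_of_eq (C D : category) (F G : functor C D) (e : F = G) (x : C) :
  is_iso (nt_of_eq e x).
Proof. rewrite nt_of_eqE; apply is_iso_hom_of_eq. Qed.

Lemma fmap_hom_of_eq (C D : category) (F : functor C D) (x y : C) (e : x = y) :
  fmap F (hom_of_eq e) = hom_of_eq (f_equal F e).
Proof. destruct e; apply fmap_id. Qed.

(** * Transposition along an adjunction, and mates *)

Section Adjunction.

Variables (A B : category) (F : functor A B) (G : functor B A).
Variable adj : adjunction F G.

(** The explicit [x], [y], [z] make the endpoints read [a], [b], [F (G b)] instead of convertible
    forms such as [id_functor A a], so that later rewrites match syntactically. *)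
Lemma transpose_l (a : A) (b : B) (f : hom a (G b)) :
  comp (x := a) (fmap G (comp (y := F (G b)) (z := b) (counit adj b) (fmap F f)))
    (unit adj a) = f.
Proof.
pose proof (nt_natural (unit adj) f) as e; cbn in e.
pose proof (triangle_r adj b) as t; cbn in t.
rewrite fmap_comp, <- comp_assoc, <- e, comp_assoc, t; apply comp_idl.
Qed.

Lemma transpose_r (a : A) (b : B) (g : hom (F a) b) :
  comp (y := F (G b)) (z := b) (counit adj b)
    (fmap F (comp (x := a) (fmap G g) (unit adj a))) = g.
Proof.
pose proof (nt_natural (counit adj) g) as e; cbn in e.
pose proof (triangle_l adj a) as t; cbn in t.
rewrite fmap_comp, comp_assoc, e, <- comp_assoc, t; apply comp_idr.
Qed.

Lemma counit_inj (a : A) (b : B) (f f' : hom a (G b)) :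
  counit adj b ∘ fmap F f = counit adj b ∘ fmap F f' -> f = f'.
Proof.
intros e; rewrite <- (transpose_l f), <- (transpose_l f').
exact (f_equal (fun h => fmap G h ∘ unit adj a) e).
Qed.

Lemma unit_inj (a : A) (b : B) (g g' : hom (F a) b) :
  fmap G g ∘ unit adj a = fmap G g' ∘ unit adj a -> g = g'.
Proof.
intros e; rewrite <- (transpose_r g), <- (transpose_r g').
exact (f_equal (fun h => counit adj b ∘ fmap F h) e).
Qed.

End Adjunction.
Arguments counit_inj {A B F G} adj {a b f f'} _.
Arguments unit_inj {A B F G} adj {a b g g'} _.

(** The mate of [τ] with respect to the other pair of sides of the square. *)
Definition right_mate (P A W B : category)
  (Y : functor P A) (R : functor A P) (adj : adjunction Y R)
  (X : functor W B) (R' : functor B W) (adj' : adjunction X R')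
  (G : functor P W) (G' : functor A B)
  (τ : nat_trans (X ⊙ G) (G' ⊙ Y)) : nat_trans (G ⊙ R) (R' ⊙ G').
Proof.
refine (@NatTrans A W (G ⊙ R) (R' ⊙ G')
  (fun a => fmap R' (fmap G' (counit adj a) ∘ τ (R a)) ∘ unit adj' (G (R a))) _).
intros a b f; cbn.
pose proof (nt_natural (unit adj') (fmap G (fmap R f))) as e1; cbn in e1.
pose proof (nt_natural τ (fmap R f)) as e2; cbn in e2.
pose proof (nt_natural (counit adj) f) as e3; cbn in e3.
rewrite <- comp_assoc, e1, !comp_assoc; f_equal.
rewrite <- !fmap_comp; f_equal.
rewrite <- comp_assoc, e2, !comp_assoc, <- !fmap_comp, e3; reflexivity.
Defined.

(** [right_mate] is a transpose along [adj'], so transposing back with the counit removes it. The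
    map [f] is carried along because the uses concern composites with the mate. *)
Lemma right_mate_counit (P A W B : category)
    (Y : functor P A) (R : functor A P) (adj : adjunction Y R)
    (X : functor W B) (R' : functor B W) (adj' : adjunction X R')
    (G : functor P W) (G' : functor A B) (τ : nat_trans (X ⊙ G) (G' ⊙ Y))
    (a : A) (w : W) (f : hom w (G (R a))) :
  counit adj' (G' a) ∘ fmap X (right_mate adj adj' τ a ∘ f)
  = fmap G' (counit adj a) ∘ τ (R a) ∘ fmap X f.
Proof.
rewrite (fmap_comp X), comp_assoc.
exact (f_equal (fun h => h ∘ fmap X f) (transpose_r adj' _)).
Qed.

(** [υ] slides past the counit and [χ] past the unit by naturality; what remains in the middle is
    the hypothesis at [L x]. *)
Lemma mate_natural (Q P B A : category)
    (L : functor Q P) (D : functor P Q) (adj : adjunction L D)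
    (L' : functor B A) (D' : functor A B) (adj' : adjunction L' D')
    (X1 X2 : functor Q B) (Y1 Y2 : functor P A)
    (τ1 : nat_trans (X1 ⊙ D) (D' ⊙ Y1)) (τ2 : nat_trans (X2 ⊙ D) (D' ⊙ Y2))
    (χ : nat_trans X1 X2) (υ : nat_trans Y1 Y2) :
  whisker_l D' υ • τ1 = τ2 • whisker_r χ D ->
  whisker_r υ L • mate adj adj' τ1 = mate adj adj' τ2 • whisker_l L' χ.
Proof.
intros h; apply nat_trans_ext; intros x; cbn.
pose proof (f_equal (fun γ : nat_trans _ _ => γ (L x)) h) as e; cbn in e.
pose proof (nt_natural (counit adj') (υ (L x))) as e1; cbn in e1.
pose proof (nt_natural χ (unit adj x)) as e2; cbn in e2.
rewrite !comp_assoc, <- e1, <- !comp_assoc; f_equal.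
rewrite <- !fmap_comp, comp_assoc, e, <- comp_assoc, e2; reflexivity.
Qed.

(* Under the adjunctions, precomposition with [mate adj adj' τ] corresponds to
   postcomposition with the right mate, so one is invertible when the other is. *)
Lemma beck_chevalley_right_mate (Q P W B A : category)
    (L : functor Q P) (D : functor P Q) (adj : adjunction L D)
    (L' : functor B A) (D' : functor A B) (adj' : adjunction L' D')
    (Y : functor P A) (R : functor A P) (adjY : adjunction Y R)
    (X : functor W B) (R' : functor B W) (adjX : adjunction X R')
    (S : functor Q W) (ff : forall x y (g : hom (S x) (S y)), exists! f, fmap S f = g)
    (τ : nat_trans ((X ⊙ S) ⊙ D) (D' ⊙ Y))
    (τ' : nat_trans (X ⊙ (S ⊙ D)) (D' ⊙ Y)) :
  (forall p, τ p = τ' p) ->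
  (forall a, is_iso (right_mate adjY adjX τ' a)) ->
  beck_chevalley adj adj' τ.
Proof.
(* [τ] and [τ'] have the same components under two bracketings: the mate treats [X ⊙ S] as one
   functor, the right mate [S ⊙ D]. *)
intros eτ hθ; apply is_iso_nat_trans; intros x.
(* [T] is transposition for the composite adjunction [Y L ⊣ D R]. *)
pose (T z (g : hom (Y (L x)) z) :=
  comp (x := x) (fmap D (comp (x := L x) (fmap R g) (unit adjY (L x)))) (unit adj x)).
assert (mateE : fmap D' (mate adj adj' τ x) ∘ unit adj' (X (S x))
                = τ' (L x) ∘ fmap X (fmap S (unit adj x))).
{ rewrite <- eτ; cbn.
  rewrite <- comp_assoc, <- (fmap_comp L').
  exact (transpose_l adj' (τ (L x) ∘ fmap X (fmap S (unit adj x)))). }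
(* Up to transposition, precomposing [g] with the mate is postcomposing [S (T g)] with the right
   mate. *)
assert (key : forall z (g : hom (Y (L x)) z),
  counit adjX (D' z) ∘ fmap X (right_mate adjY adjX τ' z ∘ fmap S (T z g))
  = fmap D' (g ∘ mate adj adj' τ x) ∘ unit adj' (X (S x))).
{ intros z g.
  transitivity (fmap D' g ∘ (τ' (L x) ∘ fmap X (fmap S (unit adj x)))).
  2: rewrite <- mateE, comp_assoc, fmap_comp; reflexivity.
  unfold T; cbn.
  rewrite fmap_comp, comp_assoc, transpose_r.
  rewrite !(fmap_comp S), (fmap_comp X), !comp_assoc; f_equal.
  pose proof (nt_natural τ' (comp (x := L x) (fmap R g) (unit adjY (L x)))) as e.
  cbn in e.
  rewrite <- comp_assoc, e, comp_assoc, <- fmap_comp, transpose_r; reflexivity. }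
(* The mate is epic: the right mate is monic, and [S] and both transpositions are injective. *)
assert (inj : forall z (g g' : hom (Y (L x)) z),
  g ∘ mate adj adj' τ x = g' ∘ mate adj adj' τ x -> g = g').
{ intros z g g' e.
  apply (unit_inj adjY), (unit_inj adj).
  destruct (ff _ _ (fmap S (T z g'))) as [f [_ uf]].
  assert (e' : fmap S (T z g) = fmap S (T z g')).
  { apply (is_iso_monic (hθ z)), (counit_inj adjX).
    rewrite !key, e; reflexivity. }
  exact (eq_trans (eq_sym (uf _ e')) (uf _ eq_refl)). }
(* The inverse [g] ends at the source of the mate. The identity of [z] is transposed to
   [S x -> R' (D' z)], pulled back along the right mate, lifted through [S] to [f], and transposed
   back by the inverse of [T]. *)
pose (z := L' (X (S x))).
destruct (hθ z) as [θ' [_ hθ']].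
destruct (ff _ _ (θ' ∘ (fmap R' (unit adj' (X (S x))) ∘ unit adjX (S x))))
  as [f [hf _]].
pose (g := counit adjY z ∘ fmap Y (counit adj (R z) ∘ fmap L f)).
assert (gσ : g ∘ mate adj adj' τ x = idm _).
{ assert (hT : T z g = f).
  { unfold T, g.
    refine (eq_trans (f_equal (fun h => fmap D h ∘ unit adj x) _) (transpose_l adj f)).
    exact (transpose_l adjY (counit adj (R z) ∘ fmap L f)). }
  apply (unit_inj adj'), (eq_trans (eq_sym (key z g))).
  rewrite hT, hf, comp_assoc, hθ', comp_idl.
  refine (eq_trans (transpose_r adjX (unit adj' (X (S x)))) _).
  rewrite fmap_id; symmetry; apply comp_idl. }
exists g; split; [exact gσ|].
(* By [gσ], the other composite and the identity agree after precomposition with the mate, which is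
   epic. *)
apply inj, (eq_trans (eq_sym (comp_assoc _ _ _))).
apply (eq_trans (f_equal (comp (mate adj adj' τ x)) gσ)).
rewrite comp_idl; apply comp_idr.
Qed.

(** * Comparison of Kan extensions *)

Lemma is_lan_precomp (A B D : category) (K : functor A B) (F F' : functor A D)
    (L : functor B D) (η : nat_trans F (L ⊙ K)) (α : nat_trans F' F) :
  (forall x, is_iso (α x)) -> is_lan η -> is_lan (η • α).
Proof.
intros hα hη S β.
destruct (is_iso_nat_trans hα) as [α' [α'α αα']].
destruct (hη S (nt_comp β α')) as [σ [hσ uσ]].
exists σ; split.
- apply nat_trans_ext; intros x; cbn.
  pose proof (f_equal (fun γ : nat_trans _ _ => γ x) hσ) as e; cbn in e.
  pose proof (f_equal (fun γ : nat_trans F' F' => γ x) α'α) as e'; cbn in e'.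
  rewrite comp_assoc, e, <- comp_assoc, e'; apply comp_idr.
- intros σ' h; apply uσ; subst β; apply nat_trans_ext; intros x; cbn.
  pose proof (f_equal (fun γ : nat_trans F F => γ x) αα') as e; cbn in e.
  rewrite <- !comp_assoc, e, comp_idr; reflexivity.
Qed.

(** The inverse is the factorisation of [η] through [η']; an endomorphism of a Kan extension that
    fixes the universal transformation is the identity. *)
Lemma is_lan_comparison_iso (A B D : category) (K : functor A B) (F : functor A D)
    (L L' : functor B D) (η : nat_trans F (L ⊙ K)) (η' : nat_trans F (L' ⊙ K))
    (θ : nat_trans L L') :
  is_lan η -> is_lan η' -> whisker_r θ K • η = η' ->
  is_iso (C := functor_category B D) θ.
Proof.
intros h h' e.
destruct (h' L η) as [θ' [e' _]].
assert (E : forall x, θ (K x) ∘ η x = η' x)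
  by (intros x; exact (f_equal (fun γ : nat_trans _ _ => γ x) e)).
assert (E' : forall x, θ' (K x) ∘ η' x = η x)
  by (intros x; exact (f_equal (fun γ : nat_trans _ _ => γ x) e')).
exists θ'; split.
- change (θ' • θ = nt_id L).
  destruct (h L η) as [σ [_ u]]; rewrite <- (u (θ' • θ)), <- (u (nt_id L)).
  + reflexivity.
  + apply nat_trans_ext; intros x; apply comp_idl.
  + apply nat_trans_ext; intros x; cbn; rewrite <- comp_assoc, E; apply E'.
- change (θ • θ' = nt_id L').
  destruct (h' L' η') as [σ [_ u]]; rewrite <- (u (θ • θ')), <- (u (nt_id L')).
  + reflexivity.
  + apply nat_trans_ext; intros x; apply comp_idl.
  + apply nat_trans_ext; intros x; cbn; rewrite <- comp_assoc, E'; apply E.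
Qed.

Lemma is_ran_comparison_iso (A B D : category) (K : functor A B) (F : functor A D)
    (R R' : functor B D) (ε : nat_trans (R ⊙ K) F) (ε' : nat_trans (R' ⊙ K) F) :
  is_ran ε -> is_ran ε' ->
  exists (φ : nat_trans R R') (ψ : nat_trans R' R),
    (forall x, ε' x ∘ φ (K x) = ε x) /\ (forall x, ε x ∘ ψ (K x) = ε' x) /\
    (forall y, ψ y ∘ φ y = idm _) /\ (forall y, φ y ∘ ψ y = idm _).
Proof.
intros h h'.
destruct (h' R ε) as [φ [e _]], (h R' ε') as [ψ [e' _]].
assert (E : forall x, ε' x ∘ φ (K x) = ε x)
  by (intros x; exact (f_equal (fun γ : nat_trans _ _ => γ x) e)).
assert (E' : forall x, ε x ∘ ψ (K x) = ε' x)
  by (intros x; exact (f_equal (fun γ : nat_trans _ _ => γ x) e')).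
exists φ, ψ; split; [exact E|split; [exact E'|split]]; intros y.
- change ((ψ • φ) y = nt_id R y); f_equal.
  destruct (h R ε) as [σ [_ u]]; rewrite <- (u (ψ • φ)), <- (u (nt_id R)).
  + reflexivity.
  + apply nat_trans_ext; intros x; apply comp_idr.
  + apply nat_trans_ext; intros x; cbn; rewrite comp_assoc, E'; apply E.
- change ((φ • ψ) y = nt_id R' y); f_equal.
  destruct (h' R' ε') as [σ [_ u]]; rewrite <- (u (φ • ψ)), <- (u (nt_id R')).
  + reflexivity.
  + apply nat_trans_ext; intros x; apply comp_idr.
  + apply nat_trans_ext; intros x; cbn; rewrite comp_assoc, E; apply E'.
Qed.

(** * Transformations between functors out of a localisation *)

(** Equality of the records gives only a dependent equality of the maps. Transport along it yields a
    commuting square whose two sides are identities by proof irrelevance. *)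
Lemma arrow_amap_inj (C : category) (x y : C) (f g : hom x y) :
  Arrow f = Arrow g -> f = g.
Proof.
intros e.
assert (h : forall (a b : arrow C) (e : a = b),
  hom_of_eq (f_equal (@acod C) e) ∘ amap a = amap b ∘ hom_of_eq (f_equal (@adom C) e)).
{ intros a b []; cbn; rewrite comp_idl, comp_idr; reflexivity. }
specialize (h _ _ e); rewrite !hom_of_eq_id, comp_idl, comp_idr in h; exact h.
Qed.

Section LocalisationTransformations.

Variables (C : wcategory) (HC : localisation C) (D : category).
Variables S T : functor HC D.

(** The universal property of [loc] speaks of functors only; reading a transformation as a functor
    to the arrow category extends uniqueness to transformations. *)
Lemma loc_nt_eq (σ σ' : nat_trans S T) :
  (forall x, σ (loc HC x) = σ' (loc HC x)) -> σ = σ'.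
Proof.
intros e.
assert (e1 : arrow_of_nt σ = arrow_of_nt σ').
{ apply loc_functor_eq.
  transitivity (arrow_of_nt (whisker_r σ (loc HC))); [apply functor_eq|].
  transitivity (arrow_of_nt (whisker_r σ' (loc HC))); [|apply functor_eq].
  f_equal; apply nat_trans_ext; exact e. }
apply nat_trans_ext; intros y; apply arrow_amap_inj.
exact (f_equal (fun K : functor HC (arrow_category D) => K y) e1).
Qed.

(** Existence, by the same encoding: a weak equivalence goes to a square with invertible ends, and
    the inverses of the ends form the inverse square. *)
Lemma loc_nt_lift (α : nat_trans (S ⊙ loc HC) (T ⊙ loc HC)) :
  exists σ : nat_trans S T, whisker_r σ (loc HC) = α.
Proof.
assert (h : inverts_weq (arrow_of_nt α)).
{ intros x y f w.
  destruct (is_iso_fmap S (loc_inverts HC w)) as [g [gf fg]].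
  destruct (is_iso_fmap T (loc_inverts HC w)) as [g' [gf' fg']].
  assert (e : g' ∘ α y = α x ∘ g)
    by (refine (inverse_square _ fg gf'); exact (nt_natural α f)).
  exists (@ArrowHom D (Arrow (α y)) (Arrow (α x)) g g' e).
  split; apply arrow_hom_eq; assumption. }
pose (K := loc_lift HC h).
assert (eK : K ⊙ loc HC = arrow_of_nt α) by apply loc_lift_loc.
assert (ed : dom_functor D ⊙ K = S)
  by (apply loc_functor_eq; rewrite comp_functor_assoc, eK; apply functor_eq).
assert (ec : cod_functor D ⊙ K = T)
  by (apply loc_functor_eq; rewrite comp_functor_assoc, eK; apply functor_eq).
(* The ends of [K] equal [S] and [T] only propositionally, hence the two casts; they become
   identities once [K (loc HC x)] is abstracted and substituted. *)
exists (nt_of_eq ec • nt_of_arrow K • nt_of_eq (eq_sym ed)).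
apply nat_trans_ext; intros x; cbn; rewrite !nt_of_eqE.
assert (e : K (loc HC x) = @Arrow D _ _ (α x))
  by exact (f_equal (fun G : functor C (arrow_category D) => G x) eK).
match goal with |- hom_of_eq ?p ∘ _ ∘ hom_of_eq ?q = _ => generalize p q end.
revert e; cbn; generalize (K (loc HC x)); intros a e; subst a; cbn; intros p q.
rewrite !hom_of_eq_id, comp_idl; apply comp_idr.
Qed.

End LocalisationTransformations.

(** * Derived functors of homotopical functors, and change of left derived functor *)

(** Composing with the inverse of [ε] turns [α] into a transformation [S ⊙ loc ⇒ R ⊙ loc], and these
    are exactly the restrictions of transformations [S ⇒ R]. *)
Lemma is_ran_loc_iso (C : wcategory) (HC : localisation C) (D : category)
    (F : functor C D) (R : functor HC D) (ε : nat_trans (R ⊙ loc HC) F) :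
  (forall x, is_iso (ε x)) -> is_ran ε.
Proof.
intros hε S α.
destruct (is_iso_nat_trans hε) as [ε' [_ εε']].
destruct (loc_nt_lift (nt_comp ε' α)) as [σ hσ].
assert (e : forall x, ε x ∘ σ (loc HC x) = α x).
{ intros x.
  pose proof (f_equal (fun γ : nat_trans _ _ => γ x) hσ) as e1; cbn in e1.
  pose proof (f_equal (fun γ : nat_trans F F => γ x) εε') as e2; cbn in e2.
  rewrite e1, comp_assoc, e2; apply comp_idl. }
exists σ; split; [apply nat_trans_ext; exact e|].
intros σ' h; apply loc_nt_eq; intros x; apply (is_iso_monic (hε x)).
rewrite e; symmetry.
exact (f_equal (fun γ : nat_trans _ _ => γ x) h).
Qed.

(** Absoluteness is automatic because every functor preserves the invertibility of the structure
    transformation. *)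
Lemma Ho_fun_left_derived (C D : wcategory) (HC : localisation C)
    (HD : localisation D) (F : functor C D) (h : homotopical F) :
  is_left_derived (nt_of_eq (Ho_fun_loc HC HD h)).
Proof.
split; [|intros E T]; apply is_ran_loc_iso; intros x.
- apply is_iso_nt_of_eq.
- exact (is_iso_fmap T (is_iso_nt_of_eq (Ho_fun_loc HC HD h) x)).
Qed.

(** Unit and counit are transported along the comparison isomorphism of the two derived functors.
    This replaces an arbitrary derived functor of [ev] by [Ho ev] and keeps the right adjoint. *)
Lemma derived_adjunction_change_left (C D : wcategory) (HC : localisation C)
    (HD : localisation D) (F : functor C D) (G : functor D C) (adj : adjunction F G)
    (L L' : functor HC HD) (λ : nat_trans (L ⊙ loc HC) (loc HD ⊙ F))
    (λ' : nat_trans (L' ⊙ loc HC) (loc HD ⊙ F))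
    (R : functor HD HC) (ρ : nat_trans (loc HC ⊙ G) (R ⊙ loc HD)) :
  derived_adjunction adj λ ρ -> is_left_derived λ' ->
  inhabited (derived_adjunction adj λ' ρ).
Proof.
intros der h'.
destruct (is_ran_comparison_iso (proj1 (der_left der)) (proj1 h'))
  as [φ [ψ [eφ [eψ [ψφ φψ]]]]].
pose (u := whisker_l R φ • unit der).
pose (v := counit der • whisker_r ψ R).
assert (tl : forall a, v (L' a) ∘ fmap L' (u a) = idm (L' a)).
{ intros a; cbn.
  pose proof (nt_natural ψ (fmap R (φ a) ∘ unit der a)) as e; cbn in e.
  pose proof (nt_natural (counit der) (φ a)) as e'; cbn in e'.
  rewrite <- comp_assoc, e, fmap_comp, comp_assoc, comp_assoc, e'.
  pose proof (triangle_l der a) as t; cbn in t.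
  rewrite <- (comp_assoc (φ a)), t, comp_idr; apply φψ. }
assert (tr : forall b, fmap R (v b) ∘ u (R b) = idm (R b)).
{ intros b; cbn.
  rewrite comp_assoc, <- fmap_comp, <- comp_assoc, ψφ, comp_idr.
  apply triangle_r. }
constructor.
refine (@DerivedAdjunction _ _ _ _ _ _ adj _ λ' _ ρ
  (@Adjunction _ _ L' R u v tl tr) h' (der_right der) _ _).
- intros c; cbn.
  rewrite comp_assoc, <- fmap_comp, eφ; apply der_unit.
- intros d; cbn.
  pose proof (nt_natural ψ (ρ d)) as e; cbn in e.
  pose proof (der_counit der d) as k; cbn in k.
  rewrite <- comp_assoc, e, comp_assoc, k, <- comp_assoc, eψ.
  reflexivity.
Qed.

(** * Right mates of derived squares *)

Section DerivedMate.

Variables (P A W B : wcategory) (HP : localisation P) (HA : localisation A)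
  (HW : localisation W) (HB : localisation B).
Variables (Y0 : functor P A) (R0 : functor A P) (adj0 : adjunction Y0 R0).
Variables (X0 : functor W B) (R0' : functor B W) (adj0' : adjunction X0 R0').
Variables (Y : functor HP HA) (λ : nat_trans (Y ⊙ loc HP) (loc HA ⊙ Y0))
  (R : functor HA HP) (ρ : nat_trans (loc HP ⊙ R0) (R ⊙ loc HA)).
Variables (X : functor HW HB) (λ' : nat_trans (X ⊙ loc HW) (loc HB ⊙ X0))
  (R' : functor HB HW) (ρ' : nat_trans (loc HW ⊙ R0') (R' ⊙ loc HB)).
Variables (der : derived_adjunction adj0 λ ρ) (der' : derived_adjunction adj0' λ' ρ').
Variables (G0 : functor P W) (G : functor HP HW)
  (γ : nat_trans (loc HW ⊙ G0) (G ⊙ loc HP)).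
Variables (G0' : functor A B) (G' : functor HA HB)
  (γ' : nat_trans (loc HB ⊙ G0') (G' ⊙ loc HA)).
Variables (τ0 : nat_trans (X0 ⊙ G0) (G0' ⊙ Y0)) (τ : nat_trans (X ⊙ G) (G' ⊙ Y)).
(** [τ] covers [τ0]: the hexagon through the structure maps [λ], [λ'], [γ], [γ'] commutes. *)
Hypothesis τ0_τ : forall p,
  fmap G' (λ p) ∘ τ (loc HP p) ∘ fmap X (γ p)
  = γ' (Y0 p) ∘ fmap (loc HB) (τ0 p) ∘ λ' (G0 p).

(** Both sides are transposed along [X ⊣ R']. The left one unfolds by the counit compatibility of
    [der], the right one by the unit compatibility of [der'], and [τ0_τ] at [R0 a] joins them. *)
Lemma right_mate_derived (a : A) :
  right_mate der der' τ (loc HA a) ∘ fmap G (ρ a) ∘ γ (R0 a)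
  = fmap R' (γ' a) ∘ ρ' (G0' a) ∘ fmap (loc HW) (right_mate adj0 adj0' τ0 a).
Proof.
apply (counit_inj der').
transitivity (fmap G' (fmap (loc HA) (counit adj0 a) ∘ λ (R0 a))
  ∘ τ (loc HP (R0 a)) ∘ fmap X (γ (R0 a))).
- rewrite <- (comp_assoc (right_mate _ _ _ _)).
  refine (eq_trans (right_mate_counit der der' τ (a := loc HA a) _) _).
  pose proof (nt_natural τ (ρ a)) as e; cbn in e.
  pose proof (der_counit der a) as k; cbn in k.
  cbn; rewrite (fmap_comp X), comp_assoc.
  rewrite <- (comp_assoc _ _ (fmap X (fmap G _))), e, comp_assoc, <- fmap_comp, k; reflexivity.
- pose proof (τ0_τ (R0 a)) as e0; cbn in e0.
  pose proof (nt_natural γ' (counit adj0 a)) as e1; cbn in e1.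
  pose proof (nt_natural ρ' (fmap G0' (counit adj0 a) ∘ τ0 (R0 a))) as e2; cbn in e2.
  pose proof (der_unit der' (G0 (R0 a))) as k; cbn in k.
  cbn; rewrite (fmap_comp (loc HW)), comp_assoc.
  rewrite <- (comp_assoc _ _ (fmap (loc HW) (fmap R0' _))), e2.
  rewrite <- !comp_assoc, <- k.
  rewrite (comp_assoc (fmap R' _) (fmap R' _)), <- fmap_comp.
  rewrite (comp_assoc (fmap R' _) (fmap R' _)), <- (fmap_comp R').
  refine (eq_trans _ (eq_sym (transpose_r der' _))).
  rewrite (fmap_comp (loc HB)), (fmap_comp G'), !comp_assoc, e1.
  rewrite <- !comp_assoc; f_equal; rewrite !comp_assoc; exact e0.
Qed.

Lemma right_mate_derived_iso :
  (forall p, is_iso (γ p)) -> composes_with γ' ρ' ->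
  (forall a, is_iso (right_mate adj0 adj0' τ0 a)) ->
  forall a, is_iso (right_mate der der' τ a).
Proof.
intros hγ hc h0 a; apply nat_trans_is_iso.
(* [γ] whiskered with [R0], rebracketed to be composable with [push_lan G ρ]. *)
pose (γR := @NatTrans A HW (loc HW ⊙ (G0 ⊙ R0)) (G ⊙ (loc HP ⊙ R0))
  (fun a => γ (R0 a)) (nt_natural (whisker_r γ R0))).
(* [G] preserves the Kan extension [R] because it is absolute. *)
assert (l1 : is_lan (push_lan G ρ • γR)).
{ apply is_lan_precomp; [intros x; apply hγ|].
  apply (proj2 (der_right der)). }
(* A second Kan extension of the same functor [loc HW ⊙ (G0 ⊙ R0)], moved from [R0' ⊙ G0'] along the
   underlying right mate. *)
assert (l2 : is_lan (comp_rho γ' ρ' • whisker_l (loc HW) (right_mate adj0 adj0' τ0))).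
{ apply is_lan_precomp; [|exact (proj1 hc)].
  intros x; exact (is_iso_fmap (loc HW) (h0 x)). }
apply (is_lan_comparison_iso l1 l2).
apply nat_trans_ext; intros x.
etransitivity; [|exact (right_mate_derived x)].
apply comp_assoc.
Qed.

End DerivedMate.

(** An equality of transformations out of a localisation is checked on objects [loc HP p]. There
    [λ2] and [γ] can be cancelled, and the covering conditions reduce it to the equality of the
    underlying squares. *)
Lemma derived_square_natural
    (P A W B : wcategory) (HP : localisation P) (HA : localisation A)
    (HW : localisation W) (HB : localisation B)
    (Y01 Y02 : functor P A) (n : nat_trans Y01 Y02)
    (Y1 Y2 : functor HP HA) (N : nat_trans Y1 Y2)
    (λ1 : nat_trans (Y1 ⊙ loc HP) (loc HA ⊙ Y01))
    (λ2 : nat_trans (Y2 ⊙ loc HP) (loc HA ⊙ Y02))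
    (X01 X02 : functor W B) (n' : nat_trans X01 X02)
    (X1 X2 : functor HW HB) (N' : nat_trans X1 X2)
    (λ1' : nat_trans (X1 ⊙ loc HW) (loc HB ⊙ X01))
    (λ2' : nat_trans (X2 ⊙ loc HW) (loc HB ⊙ X02))
    (G0 : functor P W) (G : functor HP HW) (γ : nat_trans (loc HW ⊙ G0) (G ⊙ loc HP))
    (G0' : functor A B) (G' : functor HA HB)
    (γ' : nat_trans (loc HB ⊙ G0') (G' ⊙ loc HA))
    (τ01 : nat_trans (X01 ⊙ G0) (G0' ⊙ Y01)) (τ1 : nat_trans (X1 ⊙ G) (G' ⊙ Y1))
    (τ02 : nat_trans (X02 ⊙ G0) (G0' ⊙ Y02)) (τ2 : nat_trans (X2 ⊙ G) (G' ⊙ Y2)) :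
  (forall p, λ2 p ∘ N (loc HP p) = fmap (loc HA) (n p) ∘ λ1 p) ->
  (forall w, λ2' w ∘ N' (loc HW w) = fmap (loc HB) (n' w) ∘ λ1' w) ->
  (forall p, fmap G' (λ1 p) ∘ τ1 (loc HP p) ∘ fmap X1 (γ p)
             = γ' (Y01 p) ∘ fmap (loc HB) (τ01 p) ∘ λ1' (G0 p)) ->
  (forall p, fmap G' (λ2 p) ∘ τ2 (loc HP p) ∘ fmap X2 (γ p)
             = γ' (Y02 p) ∘ fmap (loc HB) (τ02 p) ∘ λ2' (G0 p)) ->
  (forall p, fmap G0' (n p) ∘ τ01 p = τ02 p ∘ n' (G0 p)) ->
  (forall p, is_iso (λ2 p)) -> (forall p, is_iso (γ p)) ->
  whisker_l G' N • τ1 = τ2 • whisker_r N' G.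
Proof.
intros hN hN' h1 h2 h0 hλ hγ; apply loc_nt_eq; intros p.
apply (is_iso_epic (is_iso_fmap X1 (hγ p))), (is_iso_monic (is_iso_fmap G' (hλ p))).
pose proof (nt_natural N' (γ p)) as e1.
pose proof (nt_natural γ' (n p)) as e2.
specialize (hN p); specialize (hN' (G0 p)); specialize (h1 p); specialize (h2 p).
specialize (h0 p); cbn in *.
rewrite <- !comp_assoc, e1, (comp_assoc (fmap G' (λ2 p)) (fmap G' _)), <- (fmap_comp G').
cbn; rewrite hN.
rewrite !comp_assoc, h2, fmap_comp.
rewrite <- (comp_assoc _ _ (N' _)), hN', comp_assoc.
rewrite <- (comp_assoc _ (fmap (loc HB) (τ02 p))), <- (fmap_comp (loc HB)); cbn; rewrite <- h0.
rewrite (fmap_comp (loc HB)), (comp_assoc _ (fmap (loc HB) _) (fmap (loc HB) _)), e2.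
rewrite <- !comp_assoc; f_equal; rewrite !comp_assoc; exact h1.
Qed.

(** * Interchanging the two index categories *)

Lemma fully_faithful_of_inverse (A B : category) (S : functor A B) (T : functor B A) :
  T ⊙ S = id_functor A -> S ⊙ T = id_functor B ->
  forall x y (g : hom (S x) (S y)), exists! f, fmap S f = g.
Proof.
intros e e'.
assert (faithful : forall (C D : category) (F : functor C D) (K : functor D C),
  K ⊙ F = id_functor C ->
  forall x y (f f' : hom x y), fmap F f = fmap F f' -> f = f').
{ intros C D F K k x y f f' h.
  apply (is_iso_epic (is_iso_nt_of_eq k x)).
  apply (eq_trans (eq_sym (nt_natural (nt_of_eq k) f))).
  refine (eq_trans _ (nt_natural (nt_of_eq k) f')).
  cbn; rewrite h; reflexivity. }
intros x y g.
destruct (is_iso_nt_of_eq e x) as [u [ul ur]].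
(* The preimage of [g] is [T g] with its ends cast along [T (S x) = x] and [T (S y) = y]; that
   [S f = g] is checked after applying the faithful [T]. *)
pose (f := comp (z := y) (nt_of_eq e y) (comp (x := x) (fmap T g) u)).
exists f; split.
- apply (faithful _ _ _ _ e'), (is_iso_monic (is_iso_nt_of_eq e y)).
  apply (eq_trans (nt_natural (nt_of_eq e) f)).
  unfold f; cbn in *; rewrite <- !comp_assoc, ul, comp_idr; reflexivity.
- intros f' h'; apply (faithful _ _ _ _ e); rewrite h'.
  apply (faithful _ _ _ _ e'), (is_iso_monic (is_iso_nt_of_eq e y)).
  apply (eq_trans (nt_natural (nt_of_eq e) f)).
  unfold f; cbn in *; rewrite <- !comp_assoc, ul, comp_idr; reflexivity.
Qed.

(** Evaluates a cast between functors at an object, where its ends may be convertible and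
    [hom_of_eq_id] then removes it. *)
Lemma hom_of_eq_nt (C D : category) (F G : functor C D) (e : F = G) (x : C) :
  (hom_of_eq (C := functor_category C D) e : nat_trans F G) x
  = hom_of_eq (f_equal (fun K : functor C D => K x) e).
Proof. destruct e; reflexivity. Qed.

Lemma swap_slice_swap (I J : category) (C : wcategory)
    (X : functor I (functor_category J C)) (i : I) :
  swap_slice (swap_object X) i = X i.
Proof.
refine (functor_ext (F := swap_slice (swap_object X) i) (G := X i)
  (e := fun _ => eq_refl) _).
intros j j' u; cbn; rewrite comp_idl, comp_idr; reflexivity.
Qed.

Lemma swap_object_swap (I J : category) (C : wcategory)
    (X : functor I (functor_category J C)) : swap_object (swap_object X) = X.
Proof.
refine (functor_ext (F := swap_object (swap_object X)) (G := X)
  (e := swap_slice_swap X) _).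
intros i i' u; apply nat_trans_ext; intros j; cbn.
rewrite !hom_of_eq_nt, !hom_of_eq_id, comp_idl, comp_idr; reflexivity.
Qed.

Lemma swap_swap (I J : category) (C : wcategory) :
  swap J I C ⊙ swap I J C = id_functor (diagram I (diagram J C)).
Proof.
refine (functor_ext (F := swap J I C ⊙ swap I J C) (G := id_functor _)
  (e := @swap_object_swap I J C) _).
intros X Y α; apply nat_trans_ext; intros i; apply nat_trans_ext; intros j; cbn.
rewrite !hom_of_eq_nt; cbn; rewrite !hom_of_eq_id.
rewrite comp_idl, comp_idr; reflexivity.
Qed.

Lemma Ho_fun_inverse (C D : wcategory) (HC : localisation C) (HD : localisation D)
    (F : functor C D) (G : functor D C) (hF : homotopical F) (hG : homotopical G) :
  G ⊙ F = id_functor C -> Ho_fun HD HC hG ⊙ Ho_fun HC HD hF = id_functor HC.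
Proof.
intros e; apply loc_functor_eq.
rewrite comp_functor_assoc, Ho_fun_loc, <- comp_functor_assoc, Ho_fun_loc.
rewrite comp_functor_assoc, e; destruct (loc HC); apply functor_eq.
Qed.

Lemma Ho_swap_fully_faithful (I J : category) (C : wcategory)
    (HCJI : localisation (diagram I (diagram J C)))
    (HCIJ : localisation (diagram J (diagram I C))) :
  forall x y (g : hom (Ho_fun HCJI HCIJ (swap_homotopical I J C) x)
                    (Ho_fun HCJI HCIJ (swap_homotopical I J C) y)),
  exists! f, fmap (Ho_fun HCJI HCIJ (swap_homotopical I J C)) f = g.
Proof.
refine (fully_faithful_of_inverse
  (Ho_fun_inverse _ _ _ (swap_homotopical J I C) (swap_swap I J C))
  (Ho_fun_inverse _ _ _ _ (swap_swap J I C))).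
Qed.

(** * The canonical map from [Δ J_*] to [J_* Δ] before localisation *)

Section EvDelta.

Variables (I J : category) (C : wcategory) (j : J).

(** The identity square [ev_Delta], rebracketed so that [right_mate] applies with [swap ⊙ Delta] as
    one side. *)
Definition ev_swap_Delta :
  nat_trans (ev (diagram I C) j ⊙ (swap I J C ⊙ Delta I (diagram J C)))
    (Delta I C ⊙ ev C j) :=
  @NatTrans _ _ (ev (diagram I C) j ⊙ (swap I J C ⊙ Delta I (diagram J C)))
    (Delta I C ⊙ ev C j) (fun p => nt_of_eq (ev_Delta I C j) p)
    (nt_natural (nt_of_eq (ev_Delta I C j))).

Lemma ev_swap_DeltaE (p : diagram J C) (i : I) :
  (ev_swap_Delta p : nat_trans (swap_slice (const_object I (C := diagram J C) p) j)
     (const_object I ((p : functor J C) j))) i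
  = idm ((p : functor J C) j).
Proof.
cbn; rewrite nt_of_eqE, hom_of_eq_nt, hom_of_eq_id; reflexivity.
Qed.

Variables (jr : functor C (diagram J C)) (adj : adjunction (ev C j) jr).
Variables (jr' : functor (diagram I C) (diagram J (diagram I C)))
  (adj' : adjunction (ev (diagram I C) j) jr').

(** A map from [w] to the swapped constant diagram on [p] is a cocone in [C^J] over the diagrams
    [swap_slice w i] with vertex [p]; this is its leg at [i]. [unslice] reassembles a map from
    compatible legs. *)
Definition slice (w : functor J (functor_category I C)) (p : functor J C)
    (f : nat_trans w (swap_object (const_object I (C := functor_category J C) p)))
    (i : I) : nat_trans (swap_slice w i) p.
Proof.
refine (@NatTrans J C (swap_slice w i) p
  (fun k => (f k : nat_trans (w k)
     (swap_slice (const_object I (C := functor_category J C) p) k)) i) _).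
intros k k' u.
exact (f_equal (fun γ : nat_trans (w k)
  (swap_slice (const_object I (C := functor_category J C) p) k') => γ i)
  (nt_natural f u)).
Defined.

Definition unslice (w : functor J (functor_category I C)) (p : functor J C)
    (m : forall i, nat_trans (swap_slice w i) p)
    (n : forall i i' (v : hom i i') (k : J), m i' k ∘ fmap (w k : functor I C) v = m i k) :
  nat_trans w (swap_object (const_object I (C := functor_category J C) p)).
Proof.
pose (X := const_object I (C := functor_category J C) p).
assert (n' : forall k i i' (v : hom i i'),
  m i' k ∘ fmap (w k : functor I C) v = fmap (swap_slice X k) v ∘ m i k)
  by (intros k i i' v; cbn; rewrite comp_idl; apply n).
refine (@NatTrans J (functor_category I C) w (swap_object X)
  (fun k => @NatTrans I C (w k) (swap_slice X k) (fun i => m i k) (n' k)) _).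
intros k k' u; apply nat_trans_ext; intros i.
exact (nt_natural (m i) u).
Defined.

Lemma right_mate_ev_swap_Delta (c : C) :
  is_iso (right_mate adj adj' ev_swap_Delta c).
Proof.
pose (θ := right_mate adj adj' ev_swap_Delta c).
(* Transposing [θ ∘ f] gives a cocone on the [j]-th slice of [w] whose legs are the transposes of
   the legs of [f]. *)
assert (h : forall w (f : hom w (swap I J C (Delta I (diagram J C) (jr c)))) (i : I),
  (counit adj' (Delta I C c) ∘ fmap (ev (diagram I C) j) (θ ∘ f)
   : nat_trans ((w : functor J (diagram I C)) j) (const_object I c)) i
  = counit adj c ∘ fmap (ev C j) (slice f i)).
{ intros w f i.
  refine (eq_trans (f_equal
    (fun γ : nat_trans ((w : functor J (diagram I C)) j) (const_object I c) => γ i)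
    (right_mate_counit adj adj' ev_swap_Delta (a := c) f)) _).
  refine (eq_trans (f_equal (fun g => counit adj c ∘ g ∘ slice f i j)
    (ev_swap_DeltaE (jr c) i)) _).
  rewrite comp_idr; reflexivity. }
assert (inj : forall w (f g : hom w (swap I J C (Delta I (diagram J C) (jr c)))),
  θ ∘ f = θ ∘ g -> f = g).
{ intros w f g e.
  assert (es : forall i, slice f i = slice g i).
  { intros i; apply (counit_inj adj).
    rewrite <- !h, e; reflexivity. }
  apply nat_trans_ext; intros k; apply nat_trans_ext; intros i.
  exact (f_equal (fun γ : nat_trans (swap_slice _ i) (jr c) => γ k) (es i)). }
(* The inverse is found as in the Yoneda lemma: [ε] is the cocone belonging to the identity of the
   target of [θ], and transposing its legs along [adj] gives the legs of the inverse. *)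
pose (w := jr' (Delta I C c) : functor J (functor_category I C)).
pose (ε := counit adj' (Delta I C c) : nat_trans (w j) (const_object I c)).
pose (m i := fmap jr (ε i) ∘ unit adj (swap_slice w i) : nat_trans (swap_slice w i) (jr c)).
assert (n : forall i i' (v : hom i i') (k : J),
  m i' k ∘ fmap (w k : functor I C) v = m i k).
{ intros i i' v k.
  pose (wv := whisker_r (ev_map C v) w : @hom (diagram J C) (swap_slice w i) (swap_slice w i')).
  pose proof (nt_natural (unit adj) wv) as e1.
  pose proof (nt_natural ε v) as e2; cbn in e2; rewrite comp_idl in e2.
  assert (e : (m i' : @hom (diagram J C) (swap_slice w i') (jr c)) ∘ wv = m i).
  { unfold m; rewrite <- e2, fmap_comp, <- !comp_assoc; f_equal; exact e1. }
  exact (f_equal (fun γ : nat_trans (swap_slice w i) (jr c) => γ k) e). }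
exists (unslice n).
assert (r : θ ∘ unslice n = idm _).
{ apply (counit_inj adj'), nat_trans_ext; intros i.
  apply (eq_trans (h w (unslice n) i)).
  apply (eq_trans (transpose_r adj (a := swap_slice w i) (b := c) (ε i))).
  rewrite fmap_id, comp_idr; reflexivity. }
(* [θ] is monic by [inj], so its right inverse [r] is two-sided. *)
split; [|exact r].
apply inj, (eq_trans (comp_assoc _ _ _)), (eq_trans (f_equal (fun g => g ∘ θ) r)).
rewrite comp_idl; symmetry; apply comp_idr.
Qed.

End EvDelta.

(** * The square on homotopy categories and its naturality in the index *)

Section DerivedSquare.

Variables (I J : category) (C : wcategory).
Variables (HC : localisation C)
  (HCI : localisation (diagram I C)) (HCJ : localisation (diagram J C))
  (HCJI : localisation (diagram I (diagram J C)))
  (HCIJ : localisation (diagram J (diagram I C))).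

(** The structure transformation [γ] of [DerivedMate] for the side [swap ⊙ Delta]. *)
Definition Ho_swap_Delta_rho :
  nat_trans (loc HCIJ ⊙ (swap I J C ⊙ Delta I (diagram J C)))
    ((Ho_fun HCJI HCIJ (swap_homotopical I J C)
        ⊙ Ho_fun HCJ HCJI (Delta_homotopical I (diagram J C))) ⊙ loc HCJ) :=
  comp_rho (Ho_rho HCJI HCJ (Delta_homotopical I (diagram J C)))
    (Ho_rho HCIJ HCJI (swap_homotopical I J C)).

Lemma Ho_swap_Delta_rho_iso (p : diagram J C) : is_iso (Ho_swap_Delta_rho p).
Proof.
apply is_iso_comp.
- exact (is_iso_fmap _ (is_iso_nt_of_eq
    (eq_sym (Ho_fun_loc HCJ HCJI (Delta_homotopical I (diagram J C)))) p)).
- exact (is_iso_nt_of_eq (eq_sym (Ho_fun_loc HCJI HCIJ (swap_homotopical I J C)))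
    (Delta I (diagram J C) p)).
Qed.

Variable j : J.

Definition Ho_ev_swap_Delta :
  nat_trans (Ho_fun HCIJ HCI (ev_homotopical (diagram I C) j)
      ⊙ (Ho_fun HCJI HCIJ (swap_homotopical I J C)
           ⊙ Ho_fun HCJ HCJI (Delta_homotopical I (diagram J C))))
    (Ho_fun HC HCI (Delta_homotopical I C) ⊙ Ho_fun HCJ HC (ev_homotopical C j)) :=
  @NatTrans _ _ (Ho_fun HCIJ HCI (ev_homotopical (diagram I C) j)
      ⊙ (Ho_fun HCJI HCIJ (swap_homotopical I J C)
           ⊙ Ho_fun HCJ HCJI (Delta_homotopical I (diagram J C))))
    (Ho_fun HC HCI (Delta_homotopical I C) ⊙ Ho_fun HCJ HC (ev_homotopical C j))
    (fun p => nt_of_eq (Ho_ev_Delta HC HCI HCJ HCJI HCIJ j) p)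
    (nt_natural (nt_of_eq (Ho_ev_Delta HC HCI HCJ HCJI HCIJ j))).

(* Both sides are built from identity transformations. *)
Lemma Ho_ev_swap_Delta_loc (p : diagram J C) :
  fmap (Ho_fun HC HCI (Delta_homotopical I C))
      (nt_of_eq (Ho_fun_loc HCJ HC (ev_homotopical C j)) p)
    ∘ Ho_ev_swap_Delta (loc HCJ p)
    ∘ fmap (Ho_fun HCIJ HCI (ev_homotopical (diagram I C) j)) (Ho_swap_Delta_rho p)
  = Ho_rho HCI HC (Delta_homotopical I C) (ev C j p)
    ∘ fmap (loc HCI) (ev_swap_Delta I C j p)
    ∘ nt_of_eq (Ho_fun_loc HCIJ HCI (ev_homotopical (diagram I C) j))
        (swap I J C (Delta I (diagram J C) p)).
Proof.
unfold Ho_swap_Delta_rho, Ho_ev_swap_Delta, Ho_rho; cbn.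
rewrite !nt_of_eqE, !fmap_comp, !fmap_hom_of_eq; cbn.
rewrite !hom_of_eq_comp.
apply f_equal, proof_irrelevance.
Qed.

End DerivedSquare.

Lemma ev_swap_Delta_natural (I J : category) (C : wcategory) (j j' : J) (u : hom j j')
    (p : diagram J C) :
  fmap (Delta I C) (ev_map C u p) ∘ ev_swap_Delta I C j p
  = ev_swap_Delta I C j' p
    ∘ ev_map (diagram I C) u (swap I J C (Delta I (diagram J C) p)).
Proof.
apply nat_trans_ext; intros i.
apply (eq_trans (f_equal (comp (ev_map C u p)) (ev_swap_DeltaE j p i))).
apply (eq_trans (comp_idr _)), (eq_trans (eq_sym (comp_idl _))).
exact (f_equal (fun g => g ∘ ev_map C u p) (eq_sym (ev_swap_DeltaE j' p i))).
Qed.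

Lemma Ho_ev_Delta_natural (I J : category) (C : wcategory)
    (HC : localisation C)
    (HCI : localisation (diagram I C)) (HCJ : localisation (diagram J C))
    (HCJI : localisation (diagram I (diagram J C)))
    (HCIJ : localisation (diagram J (diagram I C))) (j j' : J) (u : hom j j') :
  whisker_l (Ho_fun HC HCI (Delta_homotopical I C))
      (Ho_nt HCJ HC (ev_homotopical C j) (ev_homotopical C j') (ev_map C u))
    • nt_of_eq (Ho_ev_Delta HC HCI HCJ HCJI HCIJ j)
  = nt_of_eq (Ho_ev_Delta HC HCI HCJ HCJI HCIJ j')
    • whisker_r (Ho_ev_swap_map HCI HCJI HCIJ u)
        (Ho_fun HCJ HCJI (Delta_homotopical I (diagram J C))).
Proof.
unfold Ho_ev_swap_map.
(* The rebracketed equality comes first, since [derived_square_natural] keeps [Ho swap ⊙ Ho Δ] as a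
   single side. *)
assert (e : whisker_l (Ho_fun HC HCI (Delta_homotopical I C))
      (Ho_nt HCJ HC (ev_homotopical C j) (ev_homotopical C j') (ev_map C u))
    • Ho_ev_swap_Delta HC HCI HCJ HCJI HCIJ j
  = Ho_ev_swap_Delta HC HCI HCJ HCJI HCIJ j'
    • whisker_r (Ho_nt HCIJ HCI (ev_homotopical (diagram I C) j)
                   (ev_homotopical (diagram I C) j') (ev_map (diagram I C) u))
        (Ho_fun HCJI HCIJ (swap_homotopical I J C)
           ⊙ Ho_fun HCJ HCJI (Delta_homotopical I (diagram J C)))).
{ refine (derived_square_natural
    (fun p => f_equal (fun γ : nat_trans _ _ => γ p) (Ho_nt_loc HCJ HC _ _ _))
    (fun w => f_equal (fun γ : nat_trans _ _ => γ w) (Ho_nt_loc HCIJ HCI _ _ _))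
    (Ho_ev_swap_Delta_loc HC HCI HCJ HCJI HCIJ j)
    (Ho_ev_swap_Delta_loc HC HCI HCJ HCJI HCIJ j')
    (ev_swap_Delta_natural I u)
    (is_iso_nt_of_eq _)
    (@Ho_swap_Delta_rho_iso I J C HCJ HCJI HCIJ)). }
(* Both [Ho_nt] terms are made opaque so that [cbn] removes only the bracketing. *)
revert e; generalize (Ho_nt HCJ HC (ev_homotopical C j) (ev_homotopical C j')
  (ev_map C u)) (Ho_nt HCIJ HCI (ev_homotopical (diagram I C) j)
  (ev_homotopical (diagram I C) j') (ev_map (diagram I C) u)); intros N N' e.
apply nat_trans_ext; intros x.
pose proof (f_equal (fun γ : nat_trans _ _ => γ x) e) as ex.
cbn in ex |- *; exact ex.
Qed.

Theorem theorem9p5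
  (C : wcategory) (I J : category)
  (HC : localisation C)
  (HCI : localisation (diagram I C))
  (HCJ : localisation (diagram J C))
  (HCJI : localisation (diagram I (diagram J C)))
  (HCIJ : localisation (diagram J (diagram I C)))
  (colimJ : functor (diagram I (diagram J C)) (diagram J C))
  (adjJ : adjunction colimJ (Delta I (diagram J C)))
  (colim : functor (diagram I C) C)
  (adj : adjunction colim (Delta I C))
  (hocolimJ : functor HCJI HCJ)
  (lamJ : nat_trans (hocolimJ ⊙ loc HCJI) (loc HCJ ⊙ colimJ))
  (derJ : derived_adjunction adjJ lamJ
            (Ho_rho HCJI HCJ (Delta_homotopical I (diagram J C))))
  (hocolim : functor HCI HC)
  (lam : nat_trans (hocolim ⊙ loc HCI) (loc HC ⊙ colim))
  (der : derived_adjunction adj lam (Ho_rho HCI HC (Delta_homotopical I C))) :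
  let tau (j : J) := nt_of_eq (Ho_ev_Delta HC HCI HCJ HCJI HCIJ j) in
  let sigma (j : J) := mate derJ der (tau j) in
  (forall j : J, ev_derivable_composes HC HCI HCJ HCIJ j ->
     beck_chevalley derJ der (tau j)) /\
  (forall (j j' : J) (u : hom j j'),
     ev_derivable_composes HC HCI HCJ HCIJ j ->
     ev_derivable_composes HC HCI HCJ HCIJ j' ->
     whisker_r (Ho_nt HCJ HC (ev_homotopical C j) (ev_homotopical C j') (ev_map C u))
       hocolimJ • sigma j
     = sigma j' • whisker_l hocolim (Ho_ev_swap_map HCI HCJI HCIJ u)).
Proof.
intros tau sigma; split.
- intros j [[jr [ea [L [λ [R [ρ [d]]]]]]] [jr' [ea' [L' [λ' [R' [ρ' [[d'] hc]]]]]]]].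
  (* Derivability supplies some left derived functor of each evaluation; both are replaced by
     [Ho ev], the functor in the square. *)
  destruct (derived_adjunction_change_left d
    (Ho_fun_left_derived HCJ HC (ev_homotopical C j))) as [e].
  destruct (derived_adjunction_change_left d'
    (Ho_fun_left_derived HCIJ HCI (ev_homotopical (diagram I C) j))) as [e'].
  (* Here [S] is [Ho swap] and [X] is [Ho ev], so that [X ⊙ S] is [Ho_ev_swap j]. *)
  apply (beck_chevalley_right_mate derJ der (adjY := e) (adjX := e')
    (Ho_swap_fully_faithful (HCJI := HCJI) (HCIJ := HCIJ))
    (τ := tau j) (τ' := Ho_ev_swap_Delta HC HCI HCJ HCJI HCIJ j)).
  + reflexivity.
  + apply (right_mate_derived_iso e e'
      (Ho_ev_swap_Delta_loc HC HCI HCJ HCJI HCIJ j)).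
    * apply Ho_swap_Delta_rho_iso.
    * exact hc.
    * apply right_mate_ev_swap_Delta.
- intros j j' u _ _; apply mate_natural, Ho_ev_Delta_natural.
Qed.
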